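(* Let $F$ be a field, $L\ge 1$ an integer, and for $i=1,\ldots,L$ let $b^{(i)}(x),m^{(i)}(x)\in F[x]$ with $\deg m^{(i)}(x)\ge 1$ and $\deg b^{(i)}(x)<\deg m^{(i)}(x)$, and let $\tau^{(i)}\in\mathbb{Z}$ with $0\le\tau^{(i)}\le\deg m^{(i)}(x)$. The Basic SPI Algorithm (reverse Berlekamp--Massey algorithm) described in the context, run on this input, returns the solution (up to a scale factor) of the SPI problem with data $b^{(i)}(x),m^{(i)}(x),\tau^{(i)}$, $i=1,\ldots,L$.
   Context: $\bmod$ denotes the remainder of polynomial division, $\mathrm{lcf}$ the leading coefficient of a nonzero polynomial; the degree of the zero polynomial is $-\infty$. SPI problem: find a nonzero polynomial $\Lambda(x)\in F[x]$ of the smallest degree such that $\deg\big(b^{(i)}(x)\Lambda(x)\bmod m^{(i)}(x)\big)<\tau^{(i)}$ for all $i\in\{1,\ldots,L\}$. The solution exists and is unique up to a nonzero scale factor. Basic SPI Algorithm. Input: $b^{(i)}(x),m^{(i)}(x),\tau^{(i)}$, $i=1,\ldots,L$. Initialization: for $i=1,\ldots,L$ set $\Lambda^{(i)}(x):=0$, $d^{(i)}:=\deg m^{(i)}(x)$, $\kappa^{(i)}:=\mathrm{lcf}\,m^{(i)}(x)$. Set $\Lambda(x):=1$, $\delta:=\max_{i\in\{1,\ldots,L\}}(\deg m^{(i)}(x)-\tau^{(i)})$, $i:=1$. Main loop (repeated forever until the return statement is executed); each pass performs the following steps (a), (b), (c) in order. (a) Repeat the following until $\kappa\ne0$: if $i>1$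 then set $i:=i-1$; otherwise (i.e., $i=1$): if $\delta\le0$, return $\Lambda(x)$ and stop, else set $i:=L$ and $\delta:=\delta-1$. Then set $d:=\delta+\tau^{(i)}$ and let $\kappa$ be the coefficient of $x^d$ in $b^{(i)}(x)\Lambda(x)\bmod m^{(i)}(x)$. (b) If $d<d^{(i)}$: swap $\Lambda(x)$ with $\Lambda^{(i)}(x)$, swap $d$ with $d^{(i)}$, swap $\kappa$ with $\kappa^{(i)}$, and then set $\delta:=d-\tau^{(i)}$ (with the new value of $d$). (c) Set $\Lambda(x):=\kappa^{(i)}\Lambda(x)-\kappa\,x^{d-d^{(i)}}\Lambda^{(i)}(x)$. *)

(* Defs.v *)
From HB Require Import structures.
From mathcomp Require Import all_boot all_order all_algebra.

Set Implicit Arguments.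
Unset Strict Implicit.
Unset Printing Implicit Defensive.

Import Order.TTheory GRing.Theory Num.Theory.
Local Open Scope ring_scope.

(* The simultaneous partial-inverse (SPI) problem and the basic SPI algorithm *)
(* (reverse Berlekamp-Massey). The number of pairs (b, m) is L = n.+1; the    *)
(* indices 1, ..., L are the elements of 'I_n.+1, ord0 standing for 1 and     *)
(* ord_max for L. One pass of the main loop is: (a) search for the next       *)
(* nonzero discrepancy kappa, (b) conditional swap, (c) update of Lambda.     *)

Section SPI.

Variables (F : fieldType) (n : nat).
Implicit Types (p Lam M : {poly F}).

(* Meaningful for p != 0 only. *)
Definition deg p : int := ((size p).-1)%:Z.

(* deg p < t, with the convention deg 0 = -oo. *)
Definition deg_lt p (t : int) : Prop := p = 0 \/ deg p < t.

(* Coefficient of x^d for an integer exponent d. *)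
Definition coefz p (d : int) : F := if d is Posz k then p`_k else 0.

Variables (b m : 'I_n.+1 -> {poly F}) (tau : 'I_n.+1 -> int).

Definition spi_feasible Lam : Prop :=
  Lam != 0 /\ forall i, deg_lt ((b i * Lam) %% m i) (tau i).

Definition spi_solution Lam : Prop :=
  spi_feasible Lam /\ forall M, spi_feasible M -> (size Lam <= size M)%N.

(* The program variables. The families sLams, sds, skappas are Lambda^(i),    *)
(* d^(i), kappa^(i), as opposed to the scalars Lambda, d, kappa.              *)
Record spi_state := SpiState {
  sLam : {poly F};
  sdelta : int;
  si : 'I_n.+1;
  sd : int;
  skappa : F;
  sLams : 'I_n.+1 -> {poly F};
  sds : 'I_n.+1 -> int;
  skappas : 'I_n.+1 -> F }.

(* d and kappa are assigned before they are first read: their initial value   *)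
(* is immaterial. The unit of the iterated maximum is one of its terms.       *)
Definition spi_init : spi_state := {|
  sLam := 1;
  sdelta := \big[Num.max/deg (m ord0) - tau ord0]_(i < n.+1)
              (deg (m i) - tau i);
  si := ord0;
  sd := 0;
  skappa := 0;
  sLams := fun=> 0;
  sds := fun i => deg (m i);
  skappas := fun i => lead_coef (m i) |}.

(* The end of the body of the loop (a), with i and delta already updated. *)
Definition spi_discrepancy (s : spi_state) (i : 'I_n.+1) (delta : int) :=
  let d := delta + tau i in {|
  sLam := sLam s;
  sdelta := delta;
  si := i;
  sd := d;
  skappa := coefz ((b i * sLam s) %% m i) d;
  sLams := sLams s;
  sds := sds s;
  skappas := skappas s |}.

(* The body of the loop (a); inl Lam means that Lam is returned. *)
Definition spi_body_a (s : spi_state) : {poly F} + spi_state :=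
  if si s == ord0 then
    if sdelta s <= 0 then inl (sLam s)
    else inr (spi_discrepancy s ord_max (sdelta s - 1))
  else inr (spi_discrepancy s (inord (si s).-1) (sdelta s)).

(* "Repeat ... until kappa != 0": the test follows the body. *)
Inductive spi_step_a : spi_state -> {poly F} + spi_state -> Prop :=
| StepAReturn s Lam of
    spi_body_a s = inl Lam : spi_step_a s (inl Lam)
| StepAExit s s' of
    spi_body_a s = inr s' & skappa s' != 0 : spi_step_a s (inr s')
| StepAAgain s s' r of
    spi_body_a s = inr s' & skappa s' = 0 & spi_step_a s' r : spi_step_a s r.

Definition spi_step_b (s : spi_state) : spi_state :=
  let i := si s in
  if sd s < sds s i then {|
    sLam := sLams s i;
    sdelta := sds s i - tau i;
    si := i;
    sd := sds s i;
    skappa := skappas s i;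
    sLams := [eta sLams s with i |-> sLam s];
    sds := [eta sds s with i |-> sd s];
    skappas := [eta skappas s with i |-> skappa s] |}
  else s.

(* After step (b) one has d >= d^(i), so that the absolute value in the       *)
(* exponent only converts the difference to nat.                              *)
Definition spi_step_c (s : spi_state) : spi_state :=
  let i := si s in {|
  sLam := skappas s i *: sLam s
          - skappa s *: ('X^(`|sd s - sds s i|%N) * sLams s i);
  sdelta := sdelta s;
  si := i;
  sd := sd s;
  skappa := skappa s;
  sLams := sLams s;
  sds := sds s;
  skappas := skappas s |}.

(* Big-step semantics: the main loop entered in state s terminates and
   returns Lam. *)
Inductive spi_loop : spi_state -> {poly F} -> Prop :=
| LoopReturn s Lam of
    spi_step_a s (inl Lam) : spi_loop s Lam
| LoopAgain s s' Lam of
    spi_step_a s (inr s') & spi_loop (spi_step_c (spi_step_b s')) Lam :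
    spi_loop s Lam.

Definition spi_returns Lam : Prop := spi_loop spi_init Lam.

End SPI.

(* Main.v *)
Require Import Defs.
From HB Require Import structures.
From mathcomp Require Import all_boot all_order all_algebra.
From mathcomp Require Import zify.

Set Implicit Arguments.
Unset Strict Implicit.
Unset Printing Implicit Defensive.

Import Order.TTheory GRing.Theory Num.Theory.
Local Open Scope ring_scope.

(* Order the pairs (i, d) (remainder index, degree) totally, first by d -     *)
(* tau_i and then by i; the scan of step (a) runs down this order, so the     *)
(* first nonzero discrepancy found is the leading position of the remainders  *)
(* of Lambda. The key invariant is that every nonzero M with deg M < deg      *)
(* Lambda leads at some (i, e) with e >= d^(i). An update without swap        *)
(* changes neither deg Lambda nor the d^(i). A swap at i raises deg Lambda by *)
(* d^(i) - d and lowers d^(i) to d; dividing M = q Lambda + R, the part q     *)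
(* Lambda leads at (i, d + deg q), below (i, d^(i)), hence at a position      *)
(* different from that of R, and the two leading terms cannot cancel. On      *)
(* return d^(i) >= tau_i for all i, so no such M is feasible. Each swap       *)
(* lowers the sum of the d^(i), and between swaps the scan only descends, so  *)
(* the algorithm terminates.                                                  *)

(** The linear map sending [M] to the vector [rem M] puts all remainder coefficients on one integer
    scale, [key]. Multiplication by x moves every position up by n + 1, and reduction modulo [m j]
    creates no higher one, so two vectors leading in the same component can be combined to cancel
    the leading term ([row_leads_cancel]): this is step (c). [invariant_keep] and [invariant_swap]
    carry the invariant through steps (b) and (c), [step_aP] through the scan; [invariant_solution]
    extracts optimality when the bound reaches 0, and [loop_solution] adds termination. For
    uniqueness, a combination of two optimal solutions that cancels their leading terms must vanish
    ([solution_unique]). *)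

Section Correctness.

Variables (F : fieldType) (n : nat).
Variables (b m : 'I_n.+1 -> {poly F}) (tau : 'I_n.+1 -> int).
Implicit Types (Lam M : {poly F}) (v w : 'I_n.+1 -> {poly F}) (K d e : int).

(** * Positions of coefficients and their order *)

(* Linearizes the order: d - tau_i in the scan is delta, and the ties between *)
(* equal values of delta are broken by i < n.+1.                              *)
Definition key (i : 'I_n.+1) d : int := (d - tau i) * n.+1%:Z + i%:Z.

Lemma key_inj (i j : 'I_n.+1) d e : key i d = key j e -> i = j /\ d = e.
Proof.
rewrite /key => eq_key; have := ltn_ord i; have := ltn_ord j => lt_j lt_i.
have eq_q : d - tau i = e - tau j by case: (ltgtP (d - tau i) (e - tau j)); nia.
have eq_ij : i = j by apply: val_inj => /=; nia.
by split=> //; rewrite eq_ij in eq_q; lia.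
Qed.

Lemma ltr_key (i : 'I_n.+1) d e : (key i d < key i e) = (d < e).
Proof. by rewrite /key; apply/idP/idP; nia. Qed.

Lemma key_shift (i : 'I_n.+1) d e : key i (d + e) = key i d + e * n.+1%:Z.
Proof. by rewrite /key; nia. Qed.

Definition below K v : Prop :=
  forall j (k : nat), K <= key j k%:Z -> (v j)`_k = 0.

Definition leads v (i : 'I_n.+1) (k : nat) : Prop :=
  below (key i k%:Z + 1) v /\ (v i)`_k != 0.

Lemma below_weaken K1 K2 v : K1 <= K2 -> below K1 v -> below K2 v.
Proof. by move=> le_K v_lt j k /(le_trans le_K); apply: v_lt. Qed.

(** By [key_inj] only one position has a given key, so a single coefficient test lowers the bound by
    1. *)
Lemma below_pred (i : 'I_n.+1) (k : nat) v :
  below (key i k%:Z + 1) v -> (v i)`_k = 0 -> below (key i k%:Z) v.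
Proof.
move=> v_lt vik0 j l; rewrite le_eqVlt => /orP[/eqP/key_inj[<- [<-]] //|].
by move=> lt_K; apply: v_lt; lia.
Qed.

Lemma belowD K v w : below K v -> below K w -> below K (fun j => v j + w j).
Proof.
by move=> v_lt w_lt j k le_K; rewrite coefD v_lt ?w_lt ?addr0.
Qed.

Lemma belowM K v (p : {poly F}) (k : nat) : (size p <= k.+1)%N ->
  below K v -> below (K + k%:Z * n.+1%:Z) (fun j => p * v j).
Proof.
move=> size_p v_lt j l le_K; rewrite coefM big1 // => u _.
have [le_u|lt_u] := leqP u k; last first.
  by rewrite [p`_u]nth_default ?mul0r // (leq_trans size_p).
rewrite v_lt ?mulr0 //; move: le_K.
have -> : l%:Z = (l - u)%N%:Z + u%:Z by have := ltn_ord u; lia.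
by rewrite key_shift; nia.
Qed.

Lemma below_mod K v : below K v -> below K (fun j => v j %% m j).
Proof.
move=> v_lt j k le_K; apply: nth_default; apply: leq_trans (leq_modp _ _) _.
apply/leq_sizeP => l le_l; apply: v_lt; apply: le_trans le_K _.
by rewrite /key; nia.
Qed.

Lemma leads_addr v w (i j : 'I_n.+1) (k l : nat) :
  leads v i k -> leads w j l -> key i k%:Z < key j l%:Z ->
  leads (fun u => v u + w u) j l.
Proof.
move=> [v_lt _] [w_lt w_nz] lt_ij; split.
  by apply: belowD => //; apply: below_weaken v_lt; lia.
by rewrite coefD v_lt ?add0r //; lia.
Qed.

(** * Remainders, rows and cancellation of leading terms *)

Definition rem M : 'I_n.+1 -> {poly F} := fun j => (b j * M) %% m j.

Lemma remD M N j : rem (M + N) j = rem M j + rem N j.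
Proof. by rewrite /rem mulrDr modpD. Qed.

Lemma remM M (p : {poly F}) j : rem (p * M) j = (p * rem M j) %% m j.
Proof. by rewrite /rem mulrCA modp_mul. Qed.

Lemma rem_mod M j : rem M j %% m j = rem M j.
Proof. by rewrite modp_id. Qed.

(* A row is a vector congruent to (b_j M)_j modulo (m_j)_j; a polynomial M    *)
(* such as the initial value 0 may have rows other than its remainders, for   *)
(* instance m_i at i and 0 elsewhere.                                         *)
Definition row_leads M (i : 'I_n.+1) d (c : F) : Prop :=
  exists v, [/\ forall j, v j %% m j = rem M j,
    below (key i d + 1) v, 0 <= d & (v i)`_`|d|%N = c].

Lemma row_leads_cancel A B (i : 'I_n.+1) dA dB (cA cB : F) :
  dB <= dA -> row_leads A i dA cA -> row_leads B i dB cB ->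
  below (key i dA) (rem (cB *: A - cA *: ('X^`|dA - dB|%N * B))).
Proof.
move=> le_d [v [vE v_lt dA0 vi]] [w [wE w_lt dB0 wi]].
set s := `|dA - dB|%N.
pose u j := cB%:P * v j + (- cA *: 'X^s) * w j.
have uE j : u j %% m j = rem (cB *: A - cA *: ('X^s * B)) j.
  rewrite /u modpD -[(cB%:P * v j) %% _]modp_mul vE.
  rewrite -[((- cA *: 'X^s) * w j) %% _]modp_mul wE -!remM -remD.
  by rewrite mul_polyC -scalerAl scaleNr.
suff u_lt : below (key i dA) u.
  by move=> j k le_k; rewrite -uE; apply: below_mod le_k.
have [kA dAE] : {k | dA = k%:Z} by exists `|dA|%N; lia.
have [kB dBE] : {k | dB = k%:Z} by exists `|dB|%N; lia.
have sE : (s + kB)%N = kA by rewrite /s; lia.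
subst dA dB; rewrite !absz_nat in vi wi.
(* Both summands reach at most position (i, kA), where their coefficients are cB * cA and - cA *
   cB. *)
apply: below_pred.
  apply: belowD.
    rewrite -[X in below X]addr0 -(mul0r n.+1%:Z).
    by apply: (@belowM _ _ _ 0) => //; rewrite size_polyC leq_b1.
  have -> : key i kA%:Z + 1 = key i kB%:Z + 1 + s%:Z * n.+1%:Z.
    by rewrite -sE PoszD [s%:Z + _]addrC key_shift; lia.
  apply: belowM => //; apply: leq_trans (size_scale_leq _ _) _.
  by rewrite size_polyXn.
rewrite /u coefD coefCM -scalerAl coefZ coefXnM -sE ltnNge leq_addr /=.
by rewrite addKn sE vi wi mulNr mulrC subrr.
Qed.

(** * The invariant and its preservation *)

(** [K] is the scan bound: all positions from [K] upwards have been cleared. [inv_size] weighs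
    degree against position in units of n + 1; it keeps the update from disturbing the dominant
    term. [inv_min] certifies minimality of the degree. *)
Record invariant Lam K (Lams : 'I_n.+1 -> {poly F}) (ds : 'I_n.+1 -> int)
    (kappas : 'I_n.+1 -> F) : Prop := Invariant {
  inv_K : 0 <= K;
  inv_nz : Lam != 0;
  inv_below : below K (rem Lam);
  inv_ds : forall i, tau i <= ds i <= deg (m i);
  inv_kappas : forall i, kappas i != 0;
  inv_rows : forall i, row_leads (Lams i) i (ds i) (kappas i);
  inv_size : forall i, Lams i != 0 ->
    (size (Lams i))%:Z * n.+1%:Z - key i (ds i) <= (size Lam)%:Z * n.+1%:Z - K;
  inv_min : forall M, M != 0 -> (size M < size Lam)%N ->
    exists i (k : nat), ds i <= k%:Z /\ leads (rem M) i k }.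

Hypothesis tau_ge0 : forall i, 0 <= tau i.

Lemma invariant_pred Lam (i : 'I_n.+1) (k : nat) Lams ds kappas :
  invariant Lam (key i k%:Z + 1) Lams ds kappas -> 0 <= key i k%:Z ->
  (rem Lam i)`_k = 0 -> invariant Lam (key i k%:Z) Lams ds kappas.
Proof.
move=> [_ nz lt_K Hds Hk rows Hsize Hmin] K0 rem0; split=> //.
- exact: below_pred.
- by move=> j /Hsize; lia.
Qed.

Lemma row_leads_rem Lam (i : 'I_n.+1) (k : nat) :
  below (key i k%:Z + 1) (rem Lam) -> row_leads Lam i k%:Z (rem Lam i)`_k.
Proof. by move=> lt_K; exists (rem Lam); split=> //; apply: rem_mod. Qed.

Lemma size_shift (M : {poly F}) (k : nat) : M != 0 ->
  size ('X^k * M) = (k + size M)%N.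
Proof. by move=> nz; rewrite mulrC size_mulXn. Qed.

(** The final + 1, the one position between the scan bound and the discrepancy, makes the conclusion
    strict. *)
Lemma size_gap (x y s : nat) K :
  x%:Z * n.+1%:Z - K <= y%:Z * n.+1%:Z - (K + s%:Z * n.+1%:Z + 1) ->
  (s + x < y)%N.
Proof.
move=> le_K; rewrite -ltz_nat -(@ltr_pM2r _ n.+1%:Z) // PoszD mulrDl.
by move: le_K; lia.
Qed.

Lemma invariant_keep Lam (i : 'I_n.+1) (k : nat) Lams ds kappas :
  invariant Lam (key i k%:Z + 1) Lams ds kappas -> 0 <= key i k%:Z ->
  ds i <= k%:Z ->
  invariant (kappas i *: Lam
      - (rem Lam i)`_k *: ('X^`|k%:Z - ds i|%N * Lams i))
    (key i k%:Z) Lams ds kappas.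
Proof.
move=> [_ nz lt_K Hds Hk rows Hsize Hmin] K0 le_d.
set N := _ - _.
have sizeN : size N = size Lam.
  rewrite /N size_polyDl ?size_scale // size_polyN.
  apply: leq_ltn_trans (size_scale_leq _ _) _.
  have [->|nzi] := eqVneq (Lams i) 0.
    by rewrite mulr0 size_poly0 size_poly_gt0.
  rewrite size_shift //; have := Hsize i nzi.
  have kE : k%:Z = ds i + `|k%:Z - ds i|%N%:Z by lia.
  by rewrite [in key i k%:Z]kE key_shift; apply: size_gap.
split=> //.
- by rewrite -size_poly_gt0 sizeN size_poly_gt0.
- exact: row_leads_cancel (row_leads_rem lt_K) (rows i).
- by move=> j /Hsize; rewrite sizeN; lia.
- by rewrite sizeN.
Qed.

Lemma invariant_swap Lam (i : 'I_n.+1) (k : nat) Lams ds kappas :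
  invariant Lam (key i k%:Z + 1) Lams ds kappas -> tau i <= k%:Z ->
  (rem Lam i)`_k != 0 -> k%:Z < ds i ->
  invariant ((rem Lam i)`_k *: Lams i
      - kappas i *: ('X^`|ds i - k%:Z|%N * Lam))
    (key i (ds i)) [eta Lams with i |-> Lam] [eta ds with i |-> k%:Z]
    [eta kappas with i |-> (rem Lam i)`_k].
Proof.
move=> [_ nz lt_K Hds Hk rows Hsize Hmin] tau_k rem_nz lt_d.
have [s dsE] : {s : nat | ds i = k%:Z + s%:Z} by exists `|ds i - k%:Z|%N; lia.
rewrite [in `|_|%N]dsE addrC addKr absz_nat; set N := _ - _.
have keyE : key i (ds i) = key i k%:Z + s%:Z * n.+1%:Z.
  by rewrite dsE key_shift.
have sizeN : size N = (s + size Lam)%N.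
  have size_sLam : size (- (kappas i *: ('X^s * Lam))) = (s + size Lam)%N.
    by rewrite size_polyN size_scale ?size_shift.
  rewrite /N [_ *: _ - _]addrC size_polyDl size_sLam //.
  rewrite size_scale //; have [->|nzi] := eqVneq (Lams i) 0.
    by rewrite size_poly0 addn_gt0 size_poly_gt0 nz orbT.
  have := Hsize i nzi; rewrite keyE => le_i.
  apply: (@size_gap _ _ 0 (key i k%:Z + s%:Z * n.+1%:Z)); rewrite PoszD mulrDl.
  by move: le_i; move: (key i k%:Z) (size _) (size _) => a x y; clear; lia.
split.
- by have := Hds i; rewrite /key; nia.
- by rewrite -size_poly_gt0 sizeN addn_gt0 size_poly_gt0 nz orbT.
- rewrite /N (_ : s = `|ds i - k%:Z|%N); last by lia.
  exact: row_leads_cancel (ltW lt_d) (rows i) (row_leads_rem lt_K).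
- by move=> j /=; case: (j =P i) => [->|_] //; have := Hds i; lia.
- by move=> j /=; case: ifP => _; [apply: rem_nz | apply: Hk].
- by move=> j /=; case: (j =P i) => [->|_] //; apply: row_leads_rem.
(* Degree and position both grow by s, so [inv_size] is an equality for the stored [Lam] and gains 1
   for the other indices. *)
- have -> : (size N)%:Z * n.+1%:Z - key i (ds i)
      = (size Lam)%:Z * n.+1%:Z - key i k%:Z.
    rewrite sizeN keyE PoszD mulrDl [s%:Z * _ + _]addrC [key _ _ + _]addrC.
    by rewrite addrKA.
  move=> j /=; case: (j =P i) => [-> _|_ /Hsize le_j]; first exact: lexx.
  by apply: le_trans le_j _; rewrite lerD2l lerN2 lerDl.
move=> M M_nz; rewrite sizeN => M_small.
pose q : {poly F} := M %/ Lam; pose R : {poly F} := M %% Lam.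
have ME : M = q * Lam + R by apply: divp_eq.
have R_lt : (size R < size Lam)%N by rewrite ltn_modp.
have size_q : (size q <= s)%N.
  rewrite size_divp // leq_subLR -ltnS -addSn prednK ?size_poly_gt0 //.
  by rewrite addnC.
have leads_q : q != 0 -> leads (rem (q * Lam)) i (k + (size q).-1).
  rewrite -size_poly_gt0 => q_gt0.
  have key_q : key i (k + (size q).-1)%N%:Z + 1
      = key i k%:Z + 1 + (size q).-1%:Z * n.+1%:Z.
    by rewrite PoszD key_shift; lia.
  have qv_lt :
      below (key i (k + (size q).-1)%N%:Z + 1) (fun j => q * rem Lam j).
    by rewrite key_q; apply: belowM => //; lia.
  split=> [j l le_l|]; first by rewrite remM; apply: (below_mod qv_lt).
  have size_v : (size (rem Lam i) = k.+1)%N.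
    apply/eqP; rewrite eqn_leq; apply/andP; split.
      by apply/leq_sizeP => l lt_l; apply: lt_K; rewrite /key; nia.
    by rewrite ltnNge; apply/negP => /leq_sizeP/(_ k (leqnn k))/eqP; apply/negP.
  have v_nz : rem Lam i != 0 by rewrite -size_poly_gt0 size_v.
  have size_qv : size (q * rem Lam i) = (k + (size q).-1).+1.
    rewrite size_mul -?size_poly_gt0 ?size_v // addnS /= -[RHS]addnS.
    by rewrite prednK // addnC.
  (* The degree of the product is below k + s = [ds i], at most the degree of [m i]: no reduction
     occurs and the leading term survives. *)
  have lt_m : (size (q * rem Lam i)%R < size (m i))%N.
    rewrite size_qv; have := Hds i; rewrite dsE /deg.
    by move: q_gt0 size_q; lia.
  rewrite remM modp_small //.
  have := lead_coef_eq0 (q * rem Lam i); rewrite lead_coefE size_qv /= => ->.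
  by rewrite -size_poly_gt0 size_qv.
have [q0|q_nz] := eqVneq q 0.
  have RE : R = M by rewrite [RHS]ME q0 mul0r add0r.
  have [j [l [le_l lead_l]]] :
      exists j (l : nat), ds j <= l%:Z /\ leads (rem M) j l.
    by apply: Hmin => //; rewrite -RE.
  by exists j, l; split=> //=; case: (j =P i) => [jE|//]; subst j; lia.
have {leads_q} := leads_q q_nz; set l := (k + _)%N => leads_q.
have lt_l : l%:Z < ds i by move: q_nz; rewrite -size_poly_gt0 /l; lia.
have le_kl : (k <= l)%N by apply: leq_addr.
have [R0|R_nz] := eqVneq R 0.
  by exists i, l; rewrite ME R0 addr0 /= eqxx.
have [j [l' [le_l' leads_R]]] := Hmin R R_nz R_lt.
have ext v w i0 k0 : v =1 w -> leads v i0 k0 -> leads w i0 k0.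
  by move=> vw [v_lt v_nz]; split=> [u x /v_lt|]; rewrite -vw.
have [lt_key|lt_key|/key_inj[ij ll]] := ltgtP (key i l%:Z) (key j l'%:Z).
- exists j, l'; split.
    by move=> /=; case: (j =P i) => [jE|//]; subst j; lia.
  apply: ext (leads_addr leads_q leads_R lt_key) => u.
  by rewrite [in RHS]ME remD.
- exists i, l; split; first by rewrite /= eqxx.
  apply: ext (leads_addr leads_R leads_q lt_key) => u.
  by rewrite [in RHS]ME remD addrC.
(* Equal positions would give [ds i] <= l' = l < [ds i]. *)
- by subst j; lia.
Qed.

(** * Optimality on return and uniqueness *)

Hypothesis tau_le : forall i, tau i <= deg (m i).
Hypothesis m_gt1 : forall i, 1 <= deg (m i).

Lemma deg_ltE (p : {poly F}) (t : int) :
  0 <= t -> deg_lt p t <-> (size p)%:Z <= t.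
Proof.
rewrite /deg_lt /deg => t0; split=> [[->|]|le_t]; rewrite ?size_poly0 //.
  by lia.
have [->|nz] := eqVneq p 0; [by left | right].
by move: nz; rewrite -size_poly_gt0; lia.
Qed.

Lemma feasibleE M : spi_feasible b m tau M <->
  M != 0 /\ forall i, (size (rem M i))%:Z <= tau i.
Proof.
by split=> -[nz H]; split=> // i; apply/(deg_ltE _ (tau_ge0 i)); apply: H.
Qed.

(** A position (j, k) has key at least 0 exactly when k >= [tau j], so the bound 0 is
    feasibility. *)
Lemma invariant_solution Lam Lams ds kappas :
  invariant Lam 0 Lams ds kappas -> spi_solution b m tau Lam.
Proof.
move=> [_ nz lt_0 Hds _ _ _ Hmin]; split=> [|M /feasibleE[M_nz M_le]].
  apply/feasibleE; split=> // i; have := tau_ge0 i.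
  case tauE: (tau i) => [t|] // _.
  by apply/leq_sizeP => k le_k; apply: lt_0; rewrite /key tauE; nia.
rewrite leqNgt; apply/negP => /(Hmin M M_nz)[i [k [le_k [_ /eqP[]]]]].
have le_size : (size (rem M i) <= k)%N by have := M_le i; have := Hds i; lia.
exact: nth_default le_size.
Qed.

Lemma solution_unique Lam M : spi_solution b m tau Lam ->
  spi_solution b m tau M -> exists2 c : F, c != 0 & M = c *: Lam.
Proof.
move=> [Lam_f Lam_min] [M_f M_min].
have sizeE : size M = size Lam.
  by apply/eqP; rewrite eqn_leq M_min // Lam_min.
have /feasibleE[Lam_nz Lam_le] := Lam_f; have /feasibleE[M_nz M_le] := M_f.
pose c := lead_coef M / lead_coef Lam.
have c_nz : c != 0 by rewrite mulf_neq0 ?invr_eq0 ?lead_coef_eq0.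
exists c => //; apply/eqP; rewrite -subr_eq0; apply/negP => /negP D_nz.
suff /Lam_min : spi_feasible b m tau (M - c *: Lam).
  rewrite leqNgt => /negP[].
  have sz : size Lam = (size Lam).-1.+1 by rewrite prednK ?size_poly_gt0.
  rewrite sz ltnS; apply/leq_sizeP => k.
  rewrite leq_eqVlt => /orP[/eqP <-|lt_k].
    rewrite coefB coefZ -[in M`__]sizeE -!lead_coefE divfK ?subrr //.
    by rewrite lead_coef_eq0.
  move: lt_k; rewrite -sz => le_k.
  by rewrite coefB coefZ !nth_default ?sizeE // mulr0 subrr.
apply/feasibleE; split=> // i.
have -> : rem (M - c *: Lam) i = rem M i - c *: rem Lam i.
  by rewrite /rem mulrBr modpD modpN -scalerAr modpZl.
have le_size : (size (rem M i - c *: rem Lam i)%R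
    <= maxn (size (rem M i)) (size (rem Lam i)))%N.
  rewrite -[size (rem Lam i)](size_scale _ c_nz).
  by rewrite -[X in maxn _ X]size_polyN size_polyD.
by have := M_le i; have := Lam_le i; move: le_size; lia.
Qed.

(** * Execution of the algorithm *)

Definition state_key (s : spi_state F n) : int :=
  sdelta s * n.+1%:Z + (si s)%:Z.

Definition state_invariant (s : spi_state F n) : Prop :=
  invariant (sLam s) (state_key s) (sLams s) (sds s) (skappas s).

Lemma init_invariant : state_invariant (spi_init m tau).
Proof.
rewrite /state_invariant /state_key /=.
set delta := \big[_/_]_i _; rewrite addr0.
have le_delta i : deg (m i) - tau i <= delta by apply: le_bigmax.
have m_nz i : m i != 0.
  by have := m_gt1 i; rewrite /deg -size_poly_gt0; lia.
split.
- by have := le_delta ord0; have := tau_le ord0; nia.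
- exact: oner_neq0.
- move=> j k le_k; apply: nth_default; rewrite -ltnS.
  apply: leq_trans (_ : size (m j) <= k.+1)%N; first by rewrite ltn_modp.
  rewrite leqNgt; apply/negP => lt_k.
  (* Remainders have degree at most [deg (m j)] - 1; this spare unit of delta outweighs the
     tie-breaking index j <= n. *)
  have : k%:Z - tau j + 1 <= delta by have := le_delta j; rewrite /deg; lia.
  by have := ltn_ord j; move: le_k; rewrite /key; nia.
- by move=> i; rewrite tau_le lexx.
- by move=> i; rewrite lead_coef_eq0.
- move=> i; exists (fun j => if j == i then m i else 0); split=> //.
  + move=> j; rewrite /rem mulr0 mod0p.
    by case: eqP => [->|]; rewrite ?modpp ?mod0p.
  + move=> j k le_k; case: eqP => [jE|]; rewrite ?coef0 //; subst j.
    have lt_k : deg (m i) < k%:Z by rewrite -(ltr_key i); lia.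
    have size_m : (size (m i) <= k)%N by move: lt_k; rewrite /deg; lia.
    exact: nth_default size_m.
  + by rewrite eqxx /deg absz_nat lead_coefE.
- by move=> i; rewrite eqxx.
- by move=> M; rewrite size_poly1 ltnS leqn0 size_poly_eq0 => /negPf->.
Qed.

(** The wrap from index 0 to n with delta - 1 also lowers the key by exactly 1. At index 0, delta <=
    0 and a nonnegative key force delta = 0. *)
Lemma body_aP (s : spi_state F n) : state_invariant s ->
  spi_body_a b m tau s = inl (sLam s) /\ state_key s = 0 \/
  exists i delta,
    [/\ spi_body_a b m tau s = inr (spi_discrepancy b m tau s i delta),
    state_key s = delta * n.+1%:Z + i%:Z + 1 & 0 <= delta].
Proof.
move=> /inv_K; rewrite /state_key /spi_body_a.
have := ltn_ord (si s); case: eqP => [->|/eqP i_nz] lt_i K0.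
  case: ifP => delta_le; [left | right].
    by split=> //=; move: K0 => /=; nia.
  by exists ord_max, (sdelta s - 1); split=> //=; move: K0 => /=; nia.
right; exists (inord (si s).-1), (sdelta s); split=> //.
  by rewrite inordK; move: i_nz; rewrite -val_eqE /=; lia.
by nia.
Qed.

Lemma step_aP (s : spi_state F n) : state_invariant s ->
  spi_step_a b m tau s (inl (sLam s)) /\
    invariant (sLam s) 0 (sLams s) (sds s) (skappas s) \/
  exists i (k : nat), let s' := spi_discrepancy b m tau s i (k%:Z - tau i) in
    [/\ spi_step_a b m tau s (inr s'), (rem (sLam s) i)`_k != 0,
      invariant (sLam s) (key i k%:Z + 1) (sLams s) (sds s) (skappas s),
      tau i <= k%:Z & 0 <= key i k%:Z < state_key s].
Proof.
have [N leN] := ubnP `|state_key s|%N; elim: N => // N IH in s leN *.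
move=> inv_s.
case: (body_aP inv_s) => [[body_s key_s]|[i [delta [body_s key_s delta0]]]].
  left; split; first exact: StepAReturn.
  by rewrite -key_s.
have K0 := inv_K inv_s; have ti := tau_ge0 i.
have [k kE] : {k : nat | delta = k%:Z - tau i}.
  by exists `|(delta + tau i)%R|%N; lia.
subst delta; have keyE : state_key s = key i k%:Z + 1 by rewrite key_s.
have key0 : 0 <= key i k%:Z by rewrite /key; nia.
set s' := spi_discrepancy b m tau s i (k%:Z - tau i) in body_s *.
have kappaE : skappa s' = (rem (sLam s) i)`_k by rewrite /s' /= subrK.
have inv_k : invariant (sLam s) (key i k%:Z + 1) (sLams s) (sds s) (skappas s).
  by rewrite -keyE.
have [rem0|rem_nz] := eqVneq (rem (sLam s) i)`_k 0; last first.
  right; exists i, k; split=> //; [|lia..].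
  by apply: StepAExit => //; rewrite kappaE.
have inv_s' : state_invariant s' by apply: invariant_pred.
have key_s' : state_key s' = key i k%:Z by [].
case: (IH s' _ inv_s') => [|[step_s' inv']|[j [l [step_s' nz inv' le_l lt_l]]]].
- by rewrite key_s'; lia.
- by left; split=> //; apply: StepAAgain step_s'; rewrite ?kappaE.
- right; exists j, l; split=> //; last by move: lt_l; rewrite key_s'; lia.
  by apply: StepAAgain step_s'; rewrite ?kappaE.
Qed.

Lemma loop_solution (s : spi_state F n) : state_invariant s ->
  exists2 Lam, spi_loop b m tau s Lam & spi_solution b m tau Lam.
Proof.
(* Lexicographic induction: a swap lowers the sum, while an update without swap keeps it and lowers
   the key. *)
have [N] := ubnP (\sum_i `|(sds s i - tau i)%R|)%N.
elim: N => // N IHN in s *; have [k] := ubnP `|state_key s|%N.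
elim: k => // k IHk in s * => leK leN inv_s.
have [[step_s inv0]|[i [l [step_s nz inv_l le_l lt_l]]]] := step_aP inv_s.
  by exists (sLam s); [apply: LoopReturn | apply: invariant_solution inv0].
set s' := spi_discrepancy _ _ _ _ _ _ in step_s.
suff [Lam loop_s sol] : exists2 Lam,
    spi_loop b m tau (spi_step_c (spi_step_b tau s')) Lam
    & spi_solution b m tau Lam.
  by exists Lam => //; apply: LoopAgain loop_s.
have kappaE : skappa s' = (rem (sLam s) i)`_l by rewrite /s' /= subrK.
have dE : sd s' = l%:Z by rewrite /s' /= subrK.
rewrite /spi_step_b dE kappaE; case: ifPn => [lt_d|]; last first.
  rewrite -leNgt => le_d; apply: IHk.
  - by rewrite /state_key /=; move: lt_l; rewrite /key; lia.
  - exact: leN.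
  rewrite /state_invariant /spi_step_c kappaE dE /=.
  by apply: invariant_keep => //; lia.
apply: IHN; rewrite /state_invariant /state_key /=.
  rewrite -ltnS; apply: leq_ltn_trans leN.
  rewrite (bigD1 i) //= [X in (_ < X)%N](bigD1 i) //= eqxx -addSn leq_add //.
    by have lt_l' : l%:Z < sds s i by []; move: lt_l' le_l; lia.
  by apply: leq_sum => j /negPf->.
by rewrite eqxx; apply: invariant_swap.
Qed.

End Correctness.

Theorem theorem6 (F : fieldType) (n : nat)
    (b m : 'I_n.+1 -> {poly F}) (tau : 'I_n.+1 -> int)
    (deg_m : forall i, 1 <= deg (m i))
    (deg_b : forall i, deg_lt (b i) (deg (m i)))
    (tau_bounds : forall i, 0 <= tau i <= deg (m i)) :
  exists Lam : {poly F},
    [/\ spi_returns b m tau Lam,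
        spi_solution b m tau Lam
      & forall M : {poly F}, spi_solution b m tau M ->
          exists2 c : F, c != 0 & M = c *: Lam].
Proof.
have tau_ge0 i : 0 <= tau i by case/andP: (tau_bounds i).
have tau_le i : tau i <= deg (m i) by case/andP: (tau_bounds i).
have [Lam returns sol] :=
  loop_solution tau_ge0 (init_invariant b tau_le deg_m).
by exists Lam; split=> // M; apply: solution_unique.
Qed.
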